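(* Let $\mathbf{L}=\langle L,\wedge,\vee,\otimes,\rightarrow,0,1\rangle$ be a complete residuated lattice. For any ranked data tables $\mathcal{D}_1$, $\mathcal{D}'_1$, $\mathcal{D}_2$, $\mathcal{D}'_2$ on a relation scheme $T$ and any $a\in L$, \begin{align*} S(\mathcal{D}_1,\mathcal{D}'_1)\wedge S(\mathcal{D}_2,\mathcal{D}'_2)&\leq S(\mathcal{D}_1\cup\mathcal{D}_2,\mathcal{D}'_1\cup\mathcal{D}'_2),\\ S(\mathcal{D}_1,\mathcal{D}'_1)\wedge S(\mathcal{D}_2,\mathcal{D}'_2)&\leq S(\mathcal{D}_1\cap\mathcal{D}_2,\mathcal{D}'_1\cap\mathcal{D}'_2),\\ S(\mathcal{D}_1,\mathcal{D}'_1)\otimes S(\mathcal{D}_2,\mathcal{D}'_2)&\leq S(\mathcal{D}_1\otimes\mathcal{D}_2,\mathcal{D}'_1\otimes\mathcal{D}'_2),\\ S(\mathcal{D}_1,\mathcal{D}_2)&\leq S(a\rightarrow\mathcal{D}_1,a\rightarrow\mathcal{D}_2). \end{align*}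
   Context: A complete residuated lattice $\mathbf{L}=\langle L,\wedge,\vee,\otimes,\rightarrow,0,1\rangle$ is a complete lattice with least element $0$ and greatest element $1$ such that $\langle L,\otimes,1\rangle$ is a commutative monoid and, for all $a,b,c\in L$, $a\otimes b\leq c$ if and only if $a\leq b\rightarrow c$. $Y$ is a set of attributes; a relation scheme is any subset $T\subseteq Y$. Each $y\in Y$ has a domain $D_y$ (a set) equipped with a similarity $\approx_y\colon D_y\times D_y\to L$, i.e., $u\approx_y u=1$ and $u\approx_y v=v\approx_y u$ for all $u,v\in D_y$. Put $\mathrm{Tupl}(T)=\prod_{y\in T}D_y$; its elements $t$ (maps with $t(y)\in D_y$ for $y\in T$) are tuples over $T$. A ranked data table (RDT) on $T$ is a (finite) $\mathbf{L}$-set in $\mathrm{Tupl}(T)$, i.e., a map $\mathcal{D}\colon\mathrm{Tupl}(T)\to L$ (finite meaning that only finitely many tuples have nonzero value). Operations, for each $t\in\mathrm{Tupl}(T)$: $(\mathcal{D}_1\cup\mathcal{D}_2)(t)=\mathcal{D}_1(t)\vee\mathcal{D}_2(t)$; $(\mathcal{D}_1\cap\mathcal{D}_2)(t)=\mathcal{D}_1(t)\wedge\mathcal{D}_2(t)$; $(\mathcal{D}_1\otimes\mathcal{D}_2)(t)=\mathcal{D}_1(t)\otimes\mathcal{D}_2(t)$; and the $a$-shift $(a\rightarrow\mathcal{D})(t)=a\rightarrow\mathcal{D}(t)$ for $a\in L$ (its result is a map $\mathrm{Tupl}(T)\to L$ that need not be finite). For maps $\mathcal{D}_1,\mathcal{D}_2\colon\mathrm{Tupl}(T)\to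 L$, the subsethood degree is $S(\mathcal{D}_1,\mathcal{D}_2)=\bigwedge_{t\in\mathrm{Tupl}(T)}\bigl(\mathcal{D}_1(t)\rightarrow\mathcal{D}_2(t)\bigr)\in L$. *)

(* Defs.v *)
From HB Require Import structures.
From mathcomp Require Import all_boot all_order.
From mathcomp Require Import boolp classical_sets functions cardinality.

Set Implicit Arguments.
Unset Strict Implicit.
Unset Printing Implicit Defensive.

Import Order.TTheory.
Local Open Scope classical_set_scope.
Local Open Scope order_scope.

(* Completeness is required of all subsets, including the empty one and L. *)
HB.mixin Record isCompleteLattice d L of Order.TBLattice d L := {
  supremums_neq0 : forall A : set L, supremums A !=set0;
  infimums_neq0 : forall A : set L, infimums A !=set0;
}.

#[short(type="completeLatticeType")]
HB.structure Definition CompleteLattice d :=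
  { L of Order.TBLattice d L & isCompleteLattice d L }.

HB.mixin Record isResiduated d L of Order.TBLattice d L := {
  otimes : L -> L -> L;
  residuum : L -> L -> L;
  otimesA : associative otimes;
  otimesC : commutative otimes;
  otimes1x : left_id \top otimes;
  otimes_adj : forall a b c : L, otimes a b <= c <-> a <= residuum b c;
}.

#[short(type="completeResiduatedLatticeType")]
HB.structure Definition CompleteResiduatedLattice d :=
  { L of CompleteLattice d L & isResiduated d L }.

Declare Scope residuated_scope.
Delimit Scope residuated_scope with Res.
Reserved Notation "a ⊗ b" (at level 40, left associativity).
Reserved Notation "a ⇒ b" (at level 55, right associativity).
Notation "a ⊗ b" := (otimes a b) : residuated_scope.
Notation "a ⇒ b" := (residuum a b) : residuated_scope.
Local Open Scope residuated_scope.

Lemma otimes0x d (L : completeResiduatedLatticeType d) (b : L) :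
  \bot ⊗ b = \bot.
Proof. by apply/eqP; rewrite -lex0; apply/otimes_adj; rewrite le0x. Qed.

(* The default \top is the infimum of the empty family. *)
Definition bigInf d (L : completeLatticeType d) (A : set L) : L :=
  infimum \top A.

Record simDomain d (L : completeResiduatedLatticeType d) := SimDomain {
  sim_sort :> Type;
  sim : sim_sort -> sim_sort -> L;
  sim_refl : forall u, sim u u = \top;
  sim_sym : forall u v, sim u v = sim v u;
}.

Section RankedDataTables.
Context {d : Order.disp_t} {L : completeResiduatedLatticeType d}.
Context {Y : Type} {D : Y -> simDomain L} {T : set Y}.

Definition tupl : Type := forall y : T, D (\val y).

Record rdt := RDT {
  rdt_fun :> tupl -> L;
  rdt_finite : finite_set [set t | rdt_fun t <> \bot];
}.

Lemma rdt_union_finite (D1 D2 : rdt) :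
  finite_set [set t | D1 t `|` D2 t <> \bot].
Proof.
apply: (@sub_finite_set _ _
  ([set t | D1 t <> \bot] `|` [set t | D2 t <> \bot])%classic); last first.
  by rewrite finite_setU; split; exact: rdt_finite.
move=> t /= nz; apply: contrapT => /not_orP[/contrapT z1 /contrapT z2].
by apply: nz; rewrite z1 z2 joinxx.
Qed.

Definition rdt_union (D1 D2 : rdt) : rdt := RDT (rdt_union_finite D1 D2).

Lemma rdt_inter_finite (D1 D2 : rdt) :
  finite_set [set t | D1 t `&` D2 t <> \bot].
Proof.
apply: sub_finite_set (rdt_finite D1) => t /= nz z.
by apply: nz; rewrite z meet0x.
Qed.

Definition rdt_inter (D1 D2 : rdt) : rdt := RDT (rdt_inter_finite D1 D2).

Lemma rdt_otimes_finite (D1 D2 : rdt) :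
  finite_set [set t | D1 t ⊗ D2 t <> \bot].
Proof.
apply: sub_finite_set (rdt_finite D1) => t /= nz z.
by apply: nz; rewrite z otimes0x.
Qed.

Definition rdt_otimes (D1 D2 : rdt) : rdt := RDT (rdt_otimes_finite D1 D2).

(* Not an rdt in general: a ⇒ \bot may be nonzero at infinitely many tuples. *)
Definition shift (a : L) (D1 : tupl -> L) : tupl -> L := fun t => a ⇒ D1 t.

Definition subsethood (D1 D2 : tupl -> L) : L :=
  bigInf (range (fun t => D1 t ⇒ D2 t)).

End RankedDataTables.

Arguments tupl {d L Y} D T.
Arguments rdt {d L Y} D T.

(* Main.v *)
(* By adjunction, [c <= subsethood F G] holds iff [c ⊗ F t <= G t] for all [t],
   so each inequality reduces to a pointwise one, which follows from the
   monotonicity of [⊗], its distributivity over joins, and modus ponens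
   [subsethood F G ⊗ F t <= G t]. *)
Require Import Defs.
From mathcomp Require Import all_boot all_order.
From mathcomp Require Import boolp classical_sets functions cardinality.

Local Open Scope order_scope.
Local Open Scope residuated_scope.

Import Order.TTheory.

Section Residuated.
Context {d : Order.disp_t} {L : completeResiduatedLatticeType d}.
Implicit Types a b c e : L.

(** [infimum] falls back on [\top] when [A] is empty, where every element is a lower bound;
    otherwise it picks a member of [infimums A], which completeness makes nonempty. *)
Lemma bigInf_infimums (A : set L) : infimums A (bigInf A).
Proof.
rewrite /bigInf /infimum; case: eqP => [->|_].
  by split=> [x []|x _]; rewrite lex1.
by case: xgetP => [x _ //|none]; have [x /none] := infimums_neq0 A.
Qed.

(** Extend [b <= c] by the unit [c <= a ⇒ c ⊗ a] of the adjunction. *)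
Lemma otimes_le2l a b c : b <= c -> a ⊗ b <= a ⊗ c.
Proof.
by move=> bc; rewrite ![a ⊗ _]otimesC; apply/otimes_adj/(le_trans bc)/otimes_adj.
Qed.

Lemma otimes_le2 a b c e : a <= b -> c <= e -> a ⊗ c <= b ⊗ e.
Proof.
move=> ab ce; apply: (le_trans (otimes_le2l a _ _ ce)).
by rewrite ![_ ⊗ e]otimesC otimes_le2l.
Qed.

Lemma otimes_residuum_le a b : a ⊗ (a ⇒ b) <= b.
Proof. by rewrite otimesC; apply/otimes_adj. Qed.

(** Multiplication by [a] is a left adjoint: both hypotheses transpose to upper bounds [a ⇒ e],
    which pass to the join. *)
Lemma otimes_joinr_le a b c e : a ⊗ b <= e -> a ⊗ c <= e -> a ⊗ (b `|` c) <= e.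
Proof.
rewrite ![a ⊗ _]otimesC => /otimes_adj be /otimes_adj ce.
by apply/otimes_adj; rewrite leUx be ce.
Qed.

Section Subsethood.
Context {Y : Type} {D : Y -> simDomain L} {T : set Y}.
Implicit Types F G : tupl D T -> L.

Lemma le_subsethood F G c :
  c <= subsethood F G <-> forall t, c ⊗ F t <= G t.
Proof.
have [lb glb] := bigInf_infimums (range (fun t => F t ⇒ G t)).
split=> [cFG t|cFG].
  by apply/otimes_adj/(le_trans cFG)/lb; exists t.
by apply: glb => _ [t _ <-]; apply/otimes_adj.
Qed.

Lemma subsethood_otimes_le F G t : subsethood F G ⊗ F t <= G t.
Proof. by move: t; apply/le_subsethood. Qed.

End Subsethood.
End Residuated.

Theorem theorem1 (d : Order.disp_t) (L : completeResiduatedLatticeType d)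
    (Y : Type) (D : Y -> simDomain L) (T : set Y)
    (D1 D1' D2 D2' : rdt D T) (a : L) :
  [/\ subsethood D1 D1' `&` subsethood D2 D2'
        <= subsethood (rdt_union D1 D2) (rdt_union D1' D2'),
      subsethood D1 D1' `&` subsethood D2 D2'
        <= subsethood (rdt_inter D1 D2) (rdt_inter D1' D2'),
      subsethood D1 D1' ⊗ subsethood D2 D2'
        <= subsethood (rdt_otimes D1 D2) (rdt_otimes D1' D2')
    & subsethood D1 D2 <= subsethood (shift a D1) (shift a D2)].
Proof.
have S1 := subsethood_otimes_le D1 D1'; have S2 := subsethood_otimes_le D2 D2'.
split; apply/le_subsethood => t /=.
- apply: otimes_joinr_le.
  + by rewrite lexU2// (le_trans _ (S1 t))// otimes_le2// leIl.
  + by rewrite lexU2// (le_trans _ (S2 t)) ?orbT// otimes_le2// leIr.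
(* For each index, the meet of degrees and the meet of ranks are projected to that same index. *)
- rewrite lexI (le_trans _ (S1 t)) ?(le_trans _ (S2 t))//.
  + by rewrite otimes_le2// leIr.
  + by rewrite otimes_le2// leIl.
- have -> : subsethood D1 D1' ⊗ subsethood D2 D2' ⊗ (D1 t ⊗ D2 t) =
    (subsethood D1 D1' ⊗ D1 t) ⊗ (subsethood D2 D2' ⊗ D2 t).
    by rewrite -!otimesA; congr (_ ⊗ _); rewrite !otimesA [_ ⊗ D1 t]otimesC.
  exact: otimes_le2.
(* With [a] moved to the left, modus ponens applies twice: from [a] to [D1 t], then from [D1 t] to
   [D2 t]. *)
- apply: (proj1 (otimes_adj _ _ _)).
  rewrite -otimesA [_ ⊗ a]otimesC.
  apply: le_trans (subsethood_otimes_le D1 D2 t).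
  exact/otimes_le2l/otimes_residuum_le.
Qed.
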